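(* Let $\mathbf{k}$ be a field and $q\in\mathbf{k}$ with $q\neq 0$. For any integers $1\le k\le n$, the following identity holds in $\mathcal{H}_n$: $$\mathcal{B}_n\,\mathcal{R}_{n,k}=\Big(q^k\,\mathcal{R}_{n-1,k}+\big([n+1-k]_q+q^{n+1-k}J_n\big)\mathcal{R}_{n-1,k-1}\Big)\mathcal{B}_n .$$
   Context: The Hecke algebra $\mathcal{H}_n$ (over a field $\mathbf{k}$, parameter $q\in\mathbf{k}$) is the unital associative $\mathbf{k}$-algebra generated by $T_1,\dots,T_{n-1}$ subject to $T_i^2=(q-1)T_i+q$, $T_iT_j=T_jT_i$ for $|i-j|>1$, and $T_iT_{i+1}T_i=T_{i+1}T_iT_{i+1}$. It has a basis $(T_w)_{w\in S_n}$, where $T_w=T_{i_1}\cdots T_{i_r}$ for any reduced expression $w=s_{i_1}\cdots s_{i_r}$ with $s_i=(i,i+1)$. We regard $\mathcal{H}_{n-1}\subseteq\mathcal{H}_n$ by identifying equally named generators. Let $[k]_q=1+q+\cdots+q^{k-1}$ and $[k]!_q=[1]_q\cdots[k]_q$. For any integer $m$ set $\mathcal{B}_m=\sum_{i=1}^m T_{m-1}T_{m-2}\cdots T_i$ and $\mathcal{B}^*_m=\sum_{i=1}^m T_iT_{i+1}\cdots T_{m-1}$ (both $0$ for $m\le0$). For $n,k\ge0$: $\mathcal{B}_{n,k}=\mathcal{B}_{n-k+1}\cdots\mathcal{B}_{n-1}\mathcal{B}_n$, $\mathcal{B}^*_{n,k}=\mathcal{B}^*_n\cdots\mathcal{B}^*_{n-k+1}$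 (empty products $=1$), and $\mathcal{R}_{n,k}=\frac{1}{[k]!_q}\mathcal{B}^*_{n,k}\mathcal{B}_{n,k}$, defined for specific $q$ by specializing the corresponding element computed for indeterminate $q$ (where $\mathcal{B}^*_{n,k}\mathcal{B}_{n,k}$ has $\mathbb{Z}[q]$-coefficients divisible by $[k]!_q$). In particular $\mathcal{R}_{n-1,n}=0$. The Young–Jucys–Murphy element is $J_n=\sum_{i=1}^{n-1}q^{i-n}T_{(i,n)}$, where $(i,n)$ is the transposition. *)

(* Defs.v *)
From HB Require Import structures.
From mathcomp Require Import all_boot all_order all_algebra all_fingroup.
From mathcomp Require Import generic_quotient boolp classical_sets.

Set Implicit Arguments.
Unset Strict Implicit.
Unset Printing Implicit Defensive.

Import GRing.Theory.
Local Open Scope quotient_scope.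
Local Open Scope ring_scope.

(** The Hecke algebra is built literally from its presentation: noncommutative
    polynomial expressions in the generators, modulo the least congruence that
    contains the unital associative algebra axioms and the defining relations.
    [hGen j], with [j : 'I_n.-1], is the generator written T_(j+1). *)

Inductive hterm (R : Type) (n : nat) : Type :=
| hGen of 'I_n.-1
| hCst of R
| hAdd of hterm R n & hterm R n
| hMul of hterm R n & hterm R n.

Arguments hGen {R n}.
Arguments hCst {R} n.

HB.instance Definition _ (R : Type) (n : nat) := gen_eqMixin (hterm R n).
HB.instance Definition _ (R : Type) (n : nat) := gen_choiceMixin (hterm R n).

Inductive hcong (R : comNzRingType) (n : nat) (q : R) :
  hterm R n -> hterm R n -> Prop :=
| hc_refl x : hcong q x x
| hc_sym x y : hcong q x y -> hcong q y x
| hc_trans y x z : hcong q x y -> hcong q y z -> hcong q x z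
| hc_add x x' y y' :
    hcong q x x' -> hcong q y y' -> hcong q (hAdd x y) (hAdd x' y')
| hc_mul x x' y y' :
    hcong q x x' -> hcong q y y' -> hcong q (hMul x y) (hMul x' y')
| hc_addA x y z : hcong q (hAdd x (hAdd y z)) (hAdd (hAdd x y) z)
| hc_addC x y : hcong q (hAdd x y) (hAdd y x)
| hc_add0 x : hcong q (hAdd (hCst n 0) x) x
| hc_addN x : hcong q (hAdd (hMul (hCst n (-1)) x) x) (hCst n 0)
| hc_mulA x y z : hcong q (hMul x (hMul y z)) (hMul (hMul x y) z)
| hc_mul1 x : hcong q (hMul (hCst n 1) x) x
| hc_mulDl x y z : hcong q (hMul (hAdd x y) z) (hAdd (hMul x z) (hMul y z))
| hc_mulDr x y z : hcong q (hMul x (hAdd y z)) (hAdd (hMul x y) (hMul x z))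
| hc_cstD a b : hcong q (hCst n (a + b)) (hAdd (hCst n a) (hCst n b))
| hc_cstM a b : hcong q (hCst n (a * b)) (hMul (hCst n a) (hCst n b))
| hc_cstC a x : hcong q (hMul (hCst n a) x) (hMul x (hCst n a))
| hc_quad i :
    hcong q (hMul (hGen i) (hGen i))
            (hAdd (hMul (hCst n (q - 1)) (hGen i)) (hCst n q))
| hc_comm (i j : 'I_n.-1) : (i.+1 < j)%N ->
    hcong q (hMul (hGen i) (hGen j)) (hMul (hGen j) (hGen i))
| hc_braid (i j : 'I_n.-1) : j = i.+1 :> nat ->
    hcong q (hMul (hMul (hGen i) (hGen j)) (hGen i))
            (hMul (hMul (hGen j) (hGen i)) (hGen j)).

Definition hcongb (R : comNzRingType) (n : nat) (q : R) : rel (hterm R n) :=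
  fun x y => `[< hcong q x y >].

Lemma hcongb_refl (R : comNzRingType) n (q : R) : reflexive (@hcongb R n q).
Proof. by move=> x; apply/asboolP; exact: hc_refl. Qed.

Lemma hcongb_sym (R : comNzRingType) n (q : R) : symmetric (@hcongb R n q).
Proof.
by move=> x y; apply/idP/idP => /asboolP h; apply/asboolP; exact: hc_sym.
Qed.

Lemma hcongb_trans (R : comNzRingType) n (q : R) : transitive (@hcongb R n q).
Proof.
move=> y x z /asboolP h1 /asboolP h2; apply/asboolP; exact: hc_trans h1 h2.
Qed.

Canonical hcong_equiv (R : comNzRingType) (n : nat) (q : R) :=
  EquivRel (@hcongb R n q) (@hcongb_refl R n q) (@hcongb_sym R n q)
    (@hcongb_trans R n q).

Definition hecke (R : comNzRingType) (n : nat) (q : R) : Type :=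
  {eq_quot hcong_equiv n q}.

HB.instance Definition _ (R : comNzRingType) (n : nat) (q : R) :=
  Choice.on (hecke n q).

Section HeckeAlgebra.
Variables (R : comNzRingType) (n : nat) (q : R).
Local Notation H := (hecke n q).

Definition hpi (x : hterm R n) : H := \pi_({eq_quot hcong_equiv n q}) x.
Definition hrepr (x : H) : hterm R n :=
  repr (x : {eq_quot hcong_equiv n q}).

Lemma hreprK x : hpi (hrepr x) = x.
Proof. exact: reprK. Qed.

Lemma hpiP x y : hpi x = hpi y <-> hcong q x y.
Proof.
by split=> [/eqmodP/asboolP //|h]; apply/eqmodP; apply/asboolP.
Qed.

Lemma hrepr_pi x : hcong q (hrepr (hpi x)) x.
Proof. by apply/hpiP; rewrite hreprK. Qed.

Definition hcst (a : R) : H := hpi (hCst n a).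
Definition hadd (x y : H) : H := hpi (hAdd (hrepr x) (hrepr y)).
Definition hmul (x y : H) : H := hpi (hMul (hrepr x) (hrepr y)).
Definition hopp (x : H) : H := hmul (hcst (-1)) x.

Lemma hpiD x y : hadd (hpi x) (hpi y) = hpi (hAdd x y).
Proof. by apply/hpiP; apply: hc_add; exact: hrepr_pi. Qed.

Lemma hpiM x y : hmul (hpi x) (hpi y) = hpi (hMul x y).
Proof. by apply/hpiP; apply: hc_mul; exact: hrepr_pi. Qed.

Lemma hpiW (P : H -> Prop) : (forall x, P (hpi x)) -> forall x, P x.
Proof. by move=> h x; rewrite -[x]hreprK. Qed.

Fact haddA : associative hadd.
Proof.
elim/hpiW=> x; elim/hpiW=> y; elim/hpiW=> z.
by rewrite !hpiD; apply/hpiP; exact: hc_addA.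
Qed.

Fact haddC : commutative hadd.
Proof.
elim/hpiW=> x; elim/hpiW=> y; rewrite !hpiD; apply/hpiP; exact: hc_addC.
Qed.

Fact hadd0 : left_id (hcst 0) hadd.
Proof. by elim/hpiW=> x; rewrite hpiD; apply/hpiP; exact: hc_add0. Qed.

Fact haddN : left_inverse (hcst 0) hopp hadd.
Proof.
by elim/hpiW=> x; rewrite /hopp hpiM hpiD; apply/hpiP; exact: hc_addN.
Qed.

Fact hmulA : associative hmul.
Proof.
elim/hpiW=> x; elim/hpiW=> y; elim/hpiW=> z.
by rewrite !hpiM; apply/hpiP; exact: hc_mulA.
Qed.

Fact hcstC a x : hmul (hcst a) x = hmul x (hcst a).
Proof. by elim/hpiW: x => x; rewrite !hpiM; apply/hpiP; exact: hc_cstC. Qed.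

Fact hmul1 : left_id (hcst 1) hmul.
Proof. by elim/hpiW=> x; rewrite hpiM; apply/hpiP; exact: hc_mul1. Qed.

Fact hmulr1 : right_id (hcst 1) hmul.
Proof. by move=> x; rewrite -hcstC hmul1. Qed.

Fact hmulDl : left_distributive hmul hadd.
Proof.
elim/hpiW=> x; elim/hpiW=> y; elim/hpiW=> z.
by rewrite !(hpiD, hpiM); apply/hpiP; exact: hc_mulDl.
Qed.

Fact hmulDr : right_distributive hmul hadd.
Proof.
elim/hpiW=> x; elim/hpiW=> y; elim/hpiW=> z.
by rewrite !(hpiD, hpiM); apply/hpiP; exact: hc_mulDr.
Qed.

Fact hcstD a b : hcst (a + b) = hadd (hcst a) (hcst b).
Proof. by rewrite hpiD; apply/hpiP; exact: hc_cstD. Qed.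

Fact hcstM a b : hcst (a * b) = hmul (hcst a) (hcst b).
Proof. by rewrite hpiM; apply/hpiP; exact: hc_cstM. Qed.

(** Evaluation of expressions in an algebra [A] over [S], through a change of
    scalars [f : R -> S].  It factors through [hecke n q] as soon as the images
    of the generators satisfy the relations with parameter [f q]: this is the
    universal property of the presentation. *)

Fixpoint hterm_eval (S : comNzRingType) (A : algType S) (f : R -> S)
    (g : 'I_n.-1 -> A) (t : hterm R n) : A :=
  match t with
  | hGen j => g j
  | hCst a => (f a)%:A
  | hAdd x y => hterm_eval f g x + hterm_eval f g y
  | hMul x y => hterm_eval f g x * hterm_eval f g y
  end.

Definition hecke_relations (S : comNzRingType) (A : algType S) (p : S)
    (g : 'I_n.-1 -> A) : Prop :=
  [/\ forall i, g i * g i = (p - 1) *: g i + p%:A,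
      forall i j : 'I_n.-1, (i.+1 < j)%N -> g i * g j = g j * g i
    & forall i j : 'I_n.-1, j = i.+1 :> nat ->
        g i * g j * g i = g j * g i * g j].

Lemma hterm_eval_cong (S : comNzRingType) (A : algType S)
    (f : {rmorphism R -> S}) (g : 'I_n.-1 -> A) x y :
  hecke_relations (f q) g -> hcong q x y ->
  hterm_eval f g x = hterm_eval f g y.
Proof.
move=> [gq gc gb]; elim=> {x y} //=.
- by move=> y x z _ -> _ ->.
- by move=> x x' y y' _ -> _ ->.
- by move=> x x' y y' _ -> _ ->.
- by move=> x y z; rewrite addrA.
- by move=> x y; rewrite addrC.
- by move=> x; rewrite rmorph0 scale0r add0r.
- by move=> x; rewrite rmorphN rmorph1 rmorph0 scaleN1r scale0r mulN1r addNr.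
- by move=> x y z; rewrite mulrA.
- by move=> x; rewrite rmorph1 scale1r mul1r.
- by move=> x y z; rewrite mulrDl.
- by move=> x y z; rewrite mulrDr.
- by move=> a b; rewrite rmorphD scalerDl.
- by move=> a b; rewrite rmorphM -scalerAl mul1r scalerA.
- by move=> a x; rewrite -scalerAl mul1r -scalerAr mulr1.
- by move=> i; rewrite gq rmorphB rmorph1 -scalerAl mul1r.
Qed.

Fact hcst1_neq0 : hcst 1 <> hcst 0.
Proof.
move/hpiP => h.
have rel : hecke_relations (A := R^o) (idfun q) (fun=> q).
  split=> // i; apply: etrans (_ : (q - 1) * q + q * 1 = _) => //.
  by rewrite mulr1 mulrBl mul1r subrK.
have /eqP := hterm_eval_cong rel h.
by rewrite /= scale1r scale0r oner_eq0.
Qed.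

HB.instance Definition _ := GRing.isZmodule.Build H haddA haddC hadd0 haddN.

Fact hcst1_eq0F : hcst 1 != 0 :> H.
Proof. by apply/eqP; exact: hcst1_neq0. Qed.

HB.instance Definition _ := GRing.Zmodule_isNzRing.Build H
  hmulA hmul1 hmulr1 hmulDl hmulDr hcst1_eq0F.

Definition hscale (a : R) (x : H) : H := hcst a * x.

Fact hscaleA a b x : hscale a (hscale b x) = hscale (a * b) x.
Proof. by rewrite /hscale hcstM mulrA. Qed.

Fact hscale1 : left_id 1 hscale.
Proof. exact: mul1r. Qed.

Fact hscaleDr : right_distributive hscale +%R.
Proof. by move=> a x y; rewrite /hscale mulrDr. Qed.

Fact hscaleDl x : {morph hscale^~ x : a b / a + b}.
Proof. by move=> a b; rewrite /hscale hcstD mulrDl. Qed.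

HB.instance Definition _ := GRing.Zmodule_isLmodule.Build R H
  hscaleA hscale1 hscaleDr hscaleDl.

Fact hscaleAl (a : R) (x y : H) : a *: (x * y) = (a *: x) * y.
Proof. exact: mulrA. Qed.

HB.instance Definition _ := GRing.Lmodule_isLalgebra.Build R H hscaleAl.

Fact hscaleAr (a : R) (x y : H) : a *: (x * y) = x * (a *: y).
Proof.
by rewrite -[LHS]/(hcst a * (x * y)) mulrA [hcst a * x]hcstC -mulrA.
Qed.

HB.instance Definition _ := GRing.Lalgebra_isAlgebra.Build R H hscaleAr.

Definition hgen (j : 'I_n.-1) : H := hpi (hGen j).

Lemma hpiE x : hpi x = hterm_eval idfun hgen x.
Proof.
elim: x => [j|a|x IHx y IHy|x IHx y IHy] //=.
- by rewrite -[RHS]/(hcst a * 1) mulr1.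
- by rewrite -IHx -IHy -[RHS]/(hadd _ _) hpiD.
- by rewrite -IHx -IHy -[RHS]/(hmul _ _) hpiM.
Qed.

Lemma hgen_relations : hecke_relations q hgen.
Proof.
split=> [i|i j ij|i j ij].
- rewrite -[LHS]/(hmul _ _) hpiM.
  have -> := (hpiP _ _).2 (hc_quad q i).
  by rewrite hpiE /= -scalerAl mul1r.
- change (hmul (hgen i) (hgen j) = hmul (hgen j) (hgen i)).
  by rewrite !hpiM; apply/hpiP; exact: hc_comm.
- change (hmul (hmul (hgen i) (hgen j)) (hgen i) =
          hmul (hmul (hgen j) (hgen i)) (hgen j)).
  rewrite [hmul (hgen i) _]hpiM [hmul (hgen j) (hgen i)]hpiM !hpiM.
  by apply/hpiP; exact: hc_braid.
Qed.

(** T_i for 1 <= i <= n-1, with the usual one-based indices; other indices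
    never occur in what follows and give 0. *)
Definition hT (i : nat) : H :=
  if i is j.+1 then oapp hgen 0 (insub j) else 0.

(** The elements B_m and B*_m for m <= n, regarded in the algebra on n strands;
    both vanish for m = 0. *)
Definition hB (m : nat) : H :=
  \sum_(1 <= i < m.+1) \prod_(j <- rev (index_iota i m)) hT j.

Definition hBs (m : nat) : H :=
  \sum_(1 <= i < m.+1) \prod_(i <= j < m) hT j.

(** B_(m,k) = B_(m-k+1) ... B_m and B*_(m,k) = B*_m ... B*_(m-k+1).  If k > m,
    the factor of index 0 occurs, so the truncation of the subtraction is
    harmless. *)
Definition hBprod (m k : nat) : H := \prod_(m.+1 - k <= j < m.+1) hB j.

Definition hBsprod (m k : nat) : H :=
  \prod_(j <- rev (index_iota (m.+1 - k) m.+1)) hBs j.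

End HeckeAlgebra.

Arguments hgen {R} n q j.
Arguments hT {R} n q i.
Arguments hB {R} n q m.
Arguments hBs {R} n q m.
Arguments hBprod {R} n q m k.
Arguments hBsprod {R} n q m k.

Definition qint (R : nzRingType) (q : R) (k : nat) : R := \sum_(i < k) q ^+ i.

Definition qfact (R : nzRingType) (q : R) (k : nat) : R :=
  \prod_(1 <= j < k.+1) qint q j.

(** R_(m,k) in the generic algebra over Z[q], with q = 'X: the element r such
    that [k]!_q r = B*_(m,k) B_(m,k).  It exists because the right-hand side is
    divisible by [k]!_q, and is unique because the algebra is free over Z[q]. *)
Definition hR_generic (n m k : nat) : hecke n ('X : {poly int}) :=
  xget 0 [set r | qfact 'X k *: r = hBsprod n 'X m k * hBprod n 'X m k].

Definition spec (F : fieldType) (q : F) : {poly int} -> F :=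
  horner_eval q \o map_poly intr.

HB.instance Definition _ (F : fieldType) (q : F) :=
  GRing.RMorphism.copy (spec q) (horner_eval q \o map_poly intr).

(** The specialization 'X |-> q, T_i |-> T_i. *)
Definition hecke_spec (F : fieldType) (n : nat) (q : F)
    (x : hecke n ('X : {poly int})) : hecke n q :=
  hterm_eval (spec q) (hgen n q) (hrepr x).

Section Specialization.
Variables (F : fieldType) (n : nat) (q : F).

Lemma specX : spec q 'X = q.
Proof. by rewrite /spec /= map_polyX /horner_eval hornerX. Qed.

Lemma hecke_spec_pi t :
  hecke_spec q (hpi 'X t) = hterm_eval (spec q) (hgen n q) t.
Proof.
have rel : hecke_relations (spec q 'X) (hgen n q).
  by rewrite specX; exact: hgen_relations.
exact: (hterm_eval_cong rel (hrepr_pi _ _)).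
Qed.

Lemma hecke_spec_gen j : hecke_spec q (hgen n 'X j) = hgen n q j.
Proof. exact: hecke_spec_pi. Qed.

Lemma hecke_specD : {morph @hecke_spec F n q : x y / x + y}.
Proof.
elim/hpiW=> x; elim/hpiW=> y.
by rewrite -[_ + _ in LHS]/(hadd _ _) hpiD !hecke_spec_pi.
Qed.

Lemma hecke_specM : {morph @hecke_spec F n q : x y / x * y}.
Proof.
elim/hpiW=> x; elim/hpiW=> y.
by rewrite -[_ * _ in LHS]/(hmul _ _) hpiM !hecke_spec_pi.
Qed.

Lemma hecke_spec1 : hecke_spec q 1 = 1 :> hecke n q.
Proof. by rewrite [LHS]hecke_spec_pi /= rmorph1 scale1r. Qed.

Lemma hecke_specZ a (x : hecke n ('X : {poly int})) :
  hecke_spec q (a *: x) = spec q a *: hecke_spec q x.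
Proof.
rewrite -[a *: x]/(hcst n 'X a * x) hecke_specM [X in X * _]hecke_spec_pi /=.
by rewrite -scalerAl mul1r.
Qed.

End Specialization.

(** R_(m,k), for m <= n, regarded in the algebra on n strands. *)
Definition hR (F : fieldType) (n : nat) (q : F) (m k : nat) : hecke n q :=
  hecke_spec q (hR_generic n m k).

(** The transposition (a,b), for 1 <= a, b <= n: the element i of {1, ..., n}
    is the ordinal of value i-1. *)
Definition transp (n a b : nat) : 'S_n :=
  match insub a.-1, insub b.-1 with
  | Some i, Some j => tperm i j
  | _, _ => 1%g
  end.

(** Permutations act on the right: [(s * t)%g x = t (s x)]. *)
Definition word_perm (n : nat) (w : seq nat) : 'S_n :=
  (\prod_(i <- w) transp n i i.+1)%g.

Definition expression (n : nat) (s : 'S_n) (w : seq nat) : Prop :=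
  all (fun i => 0 < i < n)%N w /\ word_perm n w = s.

Definition reduced_expression (n : nat) (s : 'S_n) (w : seq nat) : Prop :=
  expression s w /\ forall w', expression s w' -> (size w <= size w')%N.

(** T_s, computed from some reduced expression of s; by Matsumoto's theorem the
    result does not depend on the choice. *)
Definition hTperm (R : comNzRingType) (n : nat) (q : R) (s : 'S_n) :
    hecke n q :=
  \prod_(i <- xget [::] [set w | reduced_expression s w]) hT n q i.

(** The Young-Jucys-Murphy element J_n. *)
Definition hJ (F : fieldType) (n : nat) (q : F) : hecke n q :=
  \sum_(1 <= i < n) q ^- (n - i) *: hTperm q (transp n i n).

Arguments hR {F} n q m k.
Arguments hJ {F} n q.

(* Main.v *)
Require Import Defs.
From mathcomp Require Import all_boot all_order all_algebra all_fingroup.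
From mathcomp Require Import boolp classical_sets zify ring.

(** The scalar [k]!_q cannot be cancelled over the field, so the identity is
    proved over Z[q] and then specialized.  Cancelling there requires that the
    generic algebra be torsion-free: it acts on the functions on S_n by the
    regular representation, and by Matsumoto's theorem the T_w are well defined
    and span, so that an element is determined by its image of the unit vector.

    Write P_n = q^n J_n.  From P_(m+1) = q^m T_m + T_m P_m T_m one gets
    B_n B*_n = B*_(n-1) T_(n-1) B_(n-1) + [n]_q + P_n, and the undivided
    identity then follows by induction on k: T_(n-1) commutes with
    R_(n-2,-), T_(n-1) B_(n-1) B_n = q B_(n-1) B_n, and P_n commutes with
    B*_(n-1).  Divisibility of B*_(n,k) B_(n,k) by [k]!_q holds because B_(n,k)
    is a q-eigenvector of T_i for n-k < i < n, and on such eigenvectors B*_(n,k)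
    acts as [k]!_q times a sum over shuffles. *)

Set Implicit Arguments.
Unset Strict Implicit.
Unset Printing Implicit Defensive.

Import GRing.Theory.
Local Open Scope ring_scope.

(** * Inversions and reduced words *)

Section Permutations.
Variable n : nat.
Implicit Types (p : 'S_n) (b c : 'I_n.-1) (v w : seq 'I_n.-1).

Fact lo_subproof b : (b < n)%N. Proof. by case: b => b /=; lia. Qed.
Fact hi_subproof b : (b.+1 < n)%N. Proof. by case: b => b /=; lia. Qed.
Definition lo b : 'I_n := Ordinal (lo_subproof b).
Definition hi b : 'I_n := Ordinal (hi_subproof b).
Definition srefl b : 'S_n := tperm (lo b) (hi b).
(** Permutations compose from left to right, so [srefl b * p] exchanges the values of [p] at [lo b]
    and [hi b]: ascents in position govern multiplication on the left. *)
Definition ascent p b := (p (lo b) < p (hi b))%N.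
Definition invnum p :=
  #|[set u : 'I_n * 'I_n | (u.1 < u.2)%N && (p u.2 < p u.1)%N]|.
Definition wordp w : 'S_n := (\prod_(b <- w) srefl b)%g.

Lemma srefl_lo b : srefl b (lo b) = hi b. Proof. exact: tpermL. Qed.
Lemma srefl_hi b : srefl b (hi b) = lo b. Proof. exact: tpermR. Qed.
Lemma sreflK b p : (srefl b * (srefl b * p))%g = p.
Proof. by rewrite mulgA tperm2 mul1g. Qed.

Lemma srefl_fix b (x : 'I_n) : x <> b :> nat -> x <> b.+1 :> nat -> srefl b x = x.
Proof.
move=> h1 h2; apply: tpermD; apply/eqP => h.
- by apply: h1; rewrite -h.
- by apply: h2; rewrite -h.
Qed.

Lemma perm_neq p (x y : 'I_n) : x <> y :> nat -> p x <> p y :> nat.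
Proof. by move=> xy h; apply: xy; rewrite (perm_inj (ord_inj h)). Qed.

Lemma ascent_srefl b p : ascent (srefl b * p)%g b = ~~ ascent p b.
Proof.
rewrite /ascent !permM srefl_lo srefl_hi.
have : p (lo b) <> p (hi b) :> nat by apply: perm_neq => /=; lia.
lia.
Qed.

Lemma srefl_comm b c : (b.+1 < c)%N -> commute (srefl b) (srefl c).
Proof.
move=> bc; have cb : srefl b (lo c) = lo c by apply: srefl_fix => /=; lia.
have cb' : srefl b (hi c) = hi c by apply: srefl_fix => /=; lia.
by apply/commgP/conjg_fixP; rewrite tpermJ /= !srefl_fix //=; lia.
Qed.

Lemma lo_succ b c : c = b.+1 :> nat -> lo c = hi b.
Proof. by move=> e; apply: val_inj. Qed.

Lemma srefl_braid b c : c = b.+1 :> nat ->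
  (srefl b * (srefl c * srefl b) = srefl c * (srefl b * srefl c))%g.
Proof.
move=> e; have e1 : (srefl b ^ srefl c = srefl c ^ srefl b)%g.
  have h1 : srefl c (lo b) = lo b by apply: srefl_fix => /=; lia.
  have h2 : srefl b (hi c) = hi c by apply: srefl_fix => /=; lia.
  by rewrite !tpermJ h1 h2 -(lo_succ e) srefl_lo (lo_succ e) srefl_hi.
by move: e1; rewrite !conjgE !tpermV !mulgA => ->.
Qed.

Lemma invnum1 : invnum 1 = 0%N.
Proof.
apply: eq_card0 => -[x y]; rewrite !inE /= !perm1; apply/negP; lia.
Qed.

Lemma invnumV p : invnum p^-1 = invnum p.
Proof.
rewrite /invnum -[RHS](card_imset _ (f := fun u => (p u.2, p u.1))); last first.
  by move=> [x y] [x' y'] /= [/perm_inj -> /perm_inj ->].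
apply: eq_card => -[x y]; rewrite !inE /=; apply/idP/imsetP.
- move=> /andP[h1 h2]; exists (p^-1 y, p^-1 x)%g; last by rewrite /= !permKV.
  by rewrite inE /= !permKV h1 h2.
- by case=> -[x' y']; rewrite inE /= => /andP[h1 h2] [-> ->]; rewrite !permK h1 h2.
Qed.

(** Applying [srefl b] to both entries carries the inversions of [srefl b * p] onto those of [p] and
    the single extra pair [(hi b, lo b)]. *)
Lemma invnum_srefl_ascent b p : ascent p b -> invnum (srefl b * p) = (invnum p).+1.
Proof.
move=> asc.
rewrite /invnum -(card_imset _ (f := fun u => (srefl b u.1, srefl b u.2))); last first.
  by move=> [x y] [x' y'] /= [/perm_inj -> /perm_inj ->].
set A := (X in _ = #|pred_of_set X|.+1).
have notA : (hi b, lo b) \notin A by rewrite inE /=; apply/negP; lia.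
rewrite -[RHS]/(true + #|A|)%N -notA -cardsU1.
apply: eq_card => -[x y].
rewrite !inE /= xpair_eqE.
have -> : ((x, y) \in [set (srefl b u.1, srefl b u.2) | u in
    [set u : 'I_n * 'I_n | (u.1 < u.2)%N &
      ((srefl b * p)%g u.2 < (srefl b * p)%g u.1)%N]])
  = (srefl b x < srefl b y)%N && (p y < p x)%N.
  apply/imsetP/idP.
  - case=> -[x' y']; rewrite inE /= !permM => /andP[h1 h2] [-> ->].
    by rewrite !tpermK h1 h2.
  - move=> h; exists (srefl b x, srefl b y); last by rewrite /= !tpermK.
    by rewrite inE /= !permM !tpermK.
rewrite -!val_eqE /=; move: asc; rewrite /ascent.
have neq (z t : 'I_n) : z <> t -> z <> t :> nat by move=> zt /ord_inj.
by rewrite /srefl; case: (tpermP (lo b) (hi b) x) => [->|->|/neq + /neq];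
  case: (tpermP (lo b) (hi b) y) => [->|->|/neq + /neq]; rewrite /=; lia.
Qed.

Lemma invnum_srefl_descent b p : ~~ ascent p b ->
  invnum p = (invnum (srefl b * p)).+1.
Proof.
by rewrite -ascent_srefl => /invnum_srefl_ascent <-; rewrite sreflK.
Qed.

Lemma invnum_word w : (invnum (wordp w) <= size w)%N.
Proof.
rewrite /wordp; elim: w => [|b w IH]; first by rewrite big_nil invnum1.
rewrite big_cons /=; set p := (\prod_(_ <- _) _)%g in IH *.
case: (boolP (ascent p b)) => [/invnum_srefl_ascent|/invnum_srefl_descent] => ?; lia.
Qed.

Lemma no_descent p : (forall b, ascent p b) -> p = 1%g.
Proof.
move=> h.
have step (i : nat) (hi1 : (i < n)%N) (hi2 : (i.+1 < n)%N) :
    (p (Ordinal hi1) < p (Ordinal hi2))%N.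
  have hb : (i < n.-1)%N by lia.
  have := h (Ordinal hb); rewrite /ascent.
  have -> : lo (Ordinal hb) = Ordinal hi1 by apply: val_inj.
  by have -> : hi (Ordinal hb) = Ordinal hi2 by apply: val_inj.
have up (i : nat) (hi1 : (i < n)%N) : (i <= p (Ordinal hi1))%N.
  elim: i hi1 => // i IH hi1; have hi2 : (i < n)%N by lia.
  by have := step _ hi2 hi1; have := IH hi2; lia.
have down (k i : nat) (hi1 : (i < n)%N) : (i + k = n.-1)%N -> (p (Ordinal hi1) <= i)%N.
  elim: k i hi1 => [|k IH] i hi1 e; first by have := ltn_ord (p (Ordinal hi1)); lia.
  have hi2 : (i.+1 < n)%N by lia.
  by have := step _ hi1 hi2; have := IH _ hi2; lia.
apply/permP => -[i hi1]; rewrite perm1; apply: val_inj => /=.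
have := up i hi1; have := down (n.-1 - i)%N i hi1; lia.
Qed.

(** Left multiplication at a descent lowers [invnum] by one, and only the identity has no descent.
    With [invnum_word] this makes [invnum] the Coxeter length. *)
Lemma exists_word p : exists2 w, wordp w = p & size w = invnum p.
Proof.
move: {2}(invnum p) (erefl (invnum p)) => m; elim: m p => [|m IH] p e.
  exists [::]; last by rewrite e.
  rewrite /wordp big_nil; apply/esym/no_descent => b.
  by apply/negPn/negP => /invnum_srefl_descent; lia.
have [b hb] : exists b, ~~ ascent p b.
  apply/existsP; rewrite -negb_forall; apply/negP => /forallP /no_descent e1.
  by move: e; rewrite e1 invnum1.
have e2 := invnum_srefl_descent hb.
have [|w w1 w2] := IH (srefl b * p)%g; first by lia.
by exists (b :: w); rewrite ?/wordp ?big_cons -?/(wordp _) ?w1 ?sreflK //=; lia.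
Qed.

Lemma wordp_cons b w : wordp (b :: w) = (srefl b * wordp w)%g.
Proof. exact: big_cons. Qed.

Lemma reduced_cons b w : invnum (wordp (b :: w)) = size (b :: w) ->
  ~~ ascent (wordp (b :: w)) b /\ invnum (wordp w) = size w.
Proof.
have := invnum_word w.
rewrite wordp_cons ascent_srefl negbK /=.
by case: (boolP (ascent (wordp w) b)) => [/invnum_srefl_ascent|/invnum_srefl_descent] => ? ? ?; split; lia.
Qed.

(** If reduced words of [p] start with [b] and [c], then [p] has descents at [b]
    and [c], hence also reduced words starting with both sides of the
    commutation or braid relation between [b] and [c]. *)
Lemma Matsumoto (A : pzRingType) (g : 'I_n.-1 -> A) v w :
  (forall b c, (b.+1 < c)%N -> g b * g c = g c * g b) ->
  (forall b c, c = b.+1 :> nat -> g b * g c * g b = g c * g b * g c) ->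
  wordp v = wordp w ->
  invnum (wordp v) = size v -> invnum (wordp w) = size w ->
  \prod_(b <- v) g b = \prod_(b <- w) g b.
Proof.
move=> gC gB; move: {2}(size v) (leqnn (size v)) => m.
elim: m v w => [|m IH] [|b v] [|c w] //= sz e rv rw;
  try by (move: rv rw; rewrite e => -> ?).
have [db rv'] := reduced_cons rv; have [dc rw'] := reduced_cons rw.
have eqs : size v = size w by move: rv rw; rewrite e /= => ->; case.
rewrite !big_cons.
wlog : b c v w sz e rv rw db dc rv' rw' eqs / (b <= c)%N.
  move=> H; case: (leqP b c) => [|/ltnW] bc; first exact: H.
  by apply/esym/H => //; rewrite -eqs.
rewrite leq_eqVlt => /orP[/eqP/ord_inj bc|bc].
  by move: e; rewrite -bc !wordp_cons => /mulgI e; congr (_ * _); apply: IH.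
set p := wordp (b :: v) in e rv db *; rewrite -e in rw dc.
have ev : wordp v = (srefl b * p)%g by rewrite /p wordp_cons sreflK.
have ew : wordp w = (srefl c * p)%g by rewrite e wordp_cons sreflK.
have pbc : (p (hi b) < p (lo b))%N.
  by have := @perm_neq p (lo b) (hi b); move: db; rewrite /ascent /=; lia.
have pcc : (p (hi c) < p (lo c))%N.
  by have := @perm_neq p (lo c) (hi c); move: dc; rewrite /ascent /=; lia.
case: (ltngtP b.+1 c) => [bc1|?|bc1]; [|lia|].
- have hbl : srefl b (lo c) = lo c by apply: srefl_fix => /=; lia.
  have hbh : srefl b (hi c) = hi c by apply: srefl_fix => /=; lia.
  (* [u] is two letters shorter than the given words, so [c :: u] and [b :: u] are reduced words of
     their tails, to which induction applies. *)
  have [u u1 u2] := exists_word (srefl c * (srefl b * p))%g.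
  have d1 : ~~ ascent (srefl b * p)%g c by rewrite /ascent !permM hbl hbh; lia.
  have i1 := invnum_srefl_descent d1.
  have wc : wordp (c :: u) = wordp v by rewrite wordp_cons u1 sreflK ev.
  have wb : wordp (b :: u) = wordp w.
    by rewrite wordp_cons u1 mulgA (srefl_comm bc1) -mulgA sreflK ew.
  have su : size v = (size u).+1 by rewrite -rv' ev i1 u2.
  have -> : \prod_(a <- v) g a = \prod_(a <- c :: u) g a.
    by apply: IH; rewrite ?wc //= -su.
  have -> : \prod_(a <- w) g a = \prod_(a <- b :: u) g a.
    by apply: IH; rewrite ?wb //= ?rw' -eqs.
  by rewrite !big_cons !mulrA gC.
- have bc1' : c = b.+1 :> nat by rewrite bc1.
  have hcl := lo_succ bc1'; rewrite hcl in pcc.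
  have hbh : srefl b (hi c) = hi c by apply: srefl_fix => /=; lia.
  have hcb : srefl c (lo b) = lo b by apply: srefl_fix => /=; lia.
  have [u u1 u2] := exists_word (srefl b * (srefl c * (srefl b * p)))%g.
  have d1 : ~~ ascent (srefl b * p)%g c.
    by rewrite /ascent !permM hcl hbh srefl_hi; lia.
  have d2 : ~~ ascent (srefl c * (srefl b * p))%g b.
    by rewrite /ascent !permM hcb -hcl !(srefl_lo c) srefl_lo hbh; lia.
  have i1 := invnum_srefl_descent d1.
  have i2 := invnum_srefl_descent d2.
  have u1' : wordp u = (srefl c * (srefl b * (srefl c * p)))%g.
    by rewrite u1 !mulgA -[(_ * _ * srefl b)%g]mulgA (srefl_braid bc1') !mulgA.
  have wc : wordp [:: c, b & u] = wordp v by rewrite !wordp_cons u1 !sreflK ev.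
  have wb : wordp [:: b, c & u] = wordp w by rewrite !wordp_cons u1' !sreflK ew.
  have su : size v = (size u).+2 by rewrite -rv' ev i1 i2 u2.
  have -> : \prod_(a <- v) g a = \prod_(a <- [:: c, b & u]) g a.
    by apply: IH; rewrite ?wc //= -su.
  have -> : \prod_(a <- w) g a = \prod_(a <- [:: b, c & u]) g a.
    by apply: IH; rewrite ?wb //= ?rw' -eqs.
  by rewrite !big_cons !mulrA gB.
Qed.

End Permutations.

(** * The standard basis *)

Section StandardBasis.
Variables (R : comNzRingType) (n : nat) (q : R).
Implicit Types (p : 'S_n) (b c : 'I_n.-1) (v : seq 'I_n.-1).
Local Notation Tp := (@hTperm R n q).
Local Notation Tg := (hgen n q).

Lemma transp_srefl b : transp n b.+1 b.+2 = srefl b.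
Proof.
rewrite /transp /srefl /=.
have -> : insub (b : nat) = Some (lo b) by exact: (valK (lo b)).
by have -> : insub b.+1 = Some (hi b) by exact: (valK (hi b)).
Qed.

Lemma word_perm_succ v : word_perm n [seq b.+1 | b : 'I_n.-1 <- v] = wordp v.
Proof. by rewrite /word_perm big_map; apply: eq_bigr => b _; exact: transp_srefl. Qed.

Lemma expressionP p w : expression p w <->
  exists2 v, w = [seq b.+1 | b : 'I_n.-1 <- v] & wordp v = p.
Proof.
split=> [[hw <-]|[v -> <-]]; last first.
  split; last exact: word_perm_succ.
  by apply/allP => _ /mapP[b _ ->]; case: b => b /=; lia.
elim: w hw => [_|i w IH /= /andP[hi /IH [v -> e]]].
  by exists [::]; rewrite // -word_perm_succ.
have hb : (i.-1 < n.-1)%N by lia.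
have {hi} [b ->] : exists b : 'I_n.-1, i = b.+1.
  by exists (Ordinal hb); rewrite /=; lia.
exists (b :: v) => //.
by rewrite /word_perm big_cons -/(word_perm _ _) -e transp_srefl wordp_cons.
Qed.

(** The expression chosen in [hTperm] has minimal size, hence [invnum] letters, and [Matsumoto]
    compares its product with that of [v]. *)
Lemma hTperm_word v : invnum (wordp v) = size v ->
  Tp (wordp v) = \prod_(b <- v) Tg b.
Proof.
move=> rv; rewrite /hTperm.
set P := [set w | _]%classic.
have [] : P (xget [::] P).
  apply: (@xgetPex _ [::] P); exists [seq b.+1 | b : 'I_n.-1 <- v].
  split; first by apply/expressionP; exists v.
  move=> w' /expressionP[v' -> e]; rewrite !size_map -rv -e.
  exact: invnum_word.
move/expressionP => [u eu pu] /(_ [seq b.+1 | b : 'I_n.-1 <- v]).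
rewrite eu !size_map => min.
have le : (size u <= size v)%N by apply: min; apply/expressionP; exists v.
have [_ gC gB] := hgen_relations n q.
rewrite big_map; transitivity (\prod_(b <- u) Tg b).
  by apply: eq_bigr => b _; rewrite /hT valK.
apply: Matsumoto => //; rewrite pu rv; apply/eqP.
by rewrite eqn_leq le -rv -pu invnum_word.
Qed.

Lemma hTperm1 : Tp 1%g = 1.
Proof.
have := @hTperm_word [::]; rewrite /wordp !big_nil; apply.
exact: invnum1.
Qed.

Lemma hTperm_srefl b : Tp (srefl b) = Tg b.
Proof.
have := @hTperm_word [:: b]; rewrite /wordp !big_seq1; apply.
have := @invnum_srefl_ascent n b 1; rewrite mulg1 => ->; first by rewrite invnum1.
by rewrite /ascent !perm1 /=.
Qed.

Lemma hTpermM p p' : invnum (p * p')%g = (invnum p + invnum p')%N ->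
  Tp (p * p')%g = Tp p * Tp p'.
Proof.
have [v <- sv] := exists_word p; have [v' <- sv'] := exists_word p'.
have -> : (wordp v * wordp v')%g = wordp (v ++ v') by rewrite /wordp big_cat.
by move=> e; rewrite !hTperm_word ?big_cat // size_cat sv sv' e.
Qed.

Lemma hgen_hTperm b p : Tg b * Tp p =
  if ascent p b then Tp (srefl b * p)%g
  else (q - 1) *: Tp p + q *: Tp (srefl b * p)%g.
Proof.
have asc p' : ascent p' b -> Tp (srefl b * p')%g = Tg b * Tp p'.
  move=> a; rewrite hTpermM ?hTperm_srefl // invnum_srefl_ascent //.
  have := @invnum_srefl_ascent n b 1; rewrite mulg1 invnum1 => -> //.
  by rewrite /ascent !perm1 /=.
case: ifP => [/asc -> //|/negbT h].
have h' : ascent (srefl b * p)%g b by rewrite ascent_srefl.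
have [gq _ _] := hgen_relations n q.
rewrite -{1 2}(sreflK b p) asc // mulrA gq mulrDl.
by rewrite -!scalerAl mul1r.
Qed.

(** The left regular representation on coordinates: transposing the rule for
    [T_b * T_p] turns it into a pointwise formula, see [regularE]. *)
Definition regular_gen b (f : 'S_n -> R) p : R :=
  if ascent p b then q * f (srefl b * p)%g
  else f (srefl b * p)%g + (q - 1) * f p.

(** The action is defined on terms and descends to the algebra by [regular_cong], where [hc_mulDr]
    and [hc_cstC] require its linearity in [f]. *)
Fixpoint regular (t : hterm R n) (f : 'S_n -> R) : 'S_n -> R :=
  match t with
  | hGen b => regular_gen b f
  | hCst a => fun p => a * f p
  | hAdd x y => fun p => regular x f p + regular y f p
  | hMul x y => regular x (regular y f)
  end.

Lemma regularD t f g p :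
  regular t (fun p => f p + g p) p = regular t f p + regular t g p.
Proof.
elim: t f g p => [b|a|x IHx y IHy|x IHx y IHy] f g p /=.
- by rewrite /regular_gen; case: ifP => _; ring.
- by rewrite mulrDr.
- by rewrite IHx IHy addrACA.
- by rewrite -IHx; congr (regular x _ p); apply/funext => p'; exact: IHy.
Qed.

Lemma regularZ t a f p : regular t (fun p => a * f p) p = a * regular t f p.
Proof.
elim: t f p => [b|c|x IHx y IHy|x IHx y IHy] f p /=.
- by rewrite /regular_gen; case: ifP => _; ring.
- by rewrite mulrCA.
- by rewrite IHx IHy mulrDr.
- by rewrite -IHx; congr (regular x _ p); apply/funext => p'; exact: IHy.
Qed.

Lemma regular_quad b f p :
  regular_gen b (regular_gen b f) p = (q - 1) * regular_gen b f p + q * f p.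
Proof.
by rewrite /regular_gen ascent_srefl sreflK; case: (ascent p b) => /=; ring.
Qed.

Lemma regular_comm b c f p : (b.+1 < c)%N ->
  regular_gen b (regular_gen c f) p = regular_gen c (regular_gen b f) p.
Proof.
move=> bc.
have e1 : srefl b (lo c) = lo c by apply: srefl_fix => /=; lia.
have e2 : srefl b (hi c) = hi c by apply: srefl_fix => /=; lia.
have e3 : srefl c (lo b) = lo b by apply: srefl_fix => /=; lia.
have e4 : srefl c (hi b) = hi b by apply: srefl_fix => /=; lia.
rewrite /regular_gen /ascent !permM e1 e2 e3 e4 !mulgA (srefl_comm bc).
by case: ifP => _; case: ifP => _; ring.
Qed.

Lemma regular_braid b c f p : c = b.+1 :> nat ->
  regular_gen b (regular_gen c (regular_gen b f)) p =
  regular_gen c (regular_gen b (regular_gen c f)) p.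
Proof.
move=> bc; have ec := lo_succ bc.
have e1 : srefl b (hi c) = hi c by apply: srefl_fix => /=; lia.
have e2 : srefl c (lo b) = lo b by apply: srefl_fix => /=; lia.
have e3 : srefl c (hi b) = hi c by rewrite -ec srefl_lo.
have e4 : srefl c (hi c) = hi b by rewrite srefl_hi ec.
rewrite /regular_gen /ascent !permM ec.
rewrite !(srefl_lo, srefl_hi, e1, e2, e3, e4, ec, permM) !sreflK.
have -> : (srefl b * (srefl c * (srefl b * p)) = srefl c * (srefl b * (srefl c * p)))%g.
  by rewrite !mulgA -[(srefl b * _ * _)%g]mulgA (srefl_braid bc) !mulgA.
have := @perm_neq n p (lo b) (hi b); have := @perm_neq n p (lo b) (hi c).
have := @perm_neq n p (hi b) (hi c) => /=.
(* The order of the values at three consecutive positions decides every [ascent] test; each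
   consistent order leaves a polynomial identity. *)
case: (ltngtP (p (lo b)) (p (hi b))) => h1;
case: (ltngtP (p (lo b)) (p (hi c))) => h2;
case: (ltngtP (p (hi b)) (p (hi c))) => h3; try lia.
all: by move=> _ _ _; ring.
Qed.

Lemma regular_cong x y : hcong q x y -> regular x = regular y.
Proof.
move=> h; suff H f p : regular x f p = regular y f p.
  by apply/funext => f; apply/funext => p.
elim: h f p => {x y} //=.
- by move=> x y z _ IH1 _ IH2 f p; rewrite IH1.
- by move=> x x' y y' _ IH1 _ IH2 f p; rewrite IH1 IH2.
- move=> x x' y y' _ IH1 _ IH2 f p; rewrite IH1.
  by congr (regular x' _ p); apply/funext => p'; exact: IH2.
- by move=> x y z f p; rewrite addrA.
- by move=> x y f p; rewrite addrC.
- by move=> x f p; rewrite mul0r add0r.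
- by move=> x f p; ring.
- by move=> x f p; rewrite mul1r.
- by move=> x y z f p; exact: regularD.
- by move=> a b f p; rewrite mulrDl.
- by move=> a b f p; rewrite mulrA.
- by move=> a x f p; rewrite regularZ.
- by move=> b f p; exact: regular_quad.
- by move=> b c bc f p; exact: regular_comm.
- by move=> b c bc f p; exact: regular_braid.
Qed.

Lemma regularE t f :
  \sum_p regular t f p *: Tp p = hpi q t * \sum_p f p *: Tp p.
Proof.
elim: t f => [b|a|x IHx y IHy|x IHx y IHy] f /=.
- rewrite -/(Tg b) mulr_sumr.
  under [RHS]eq_bigr => p _ do rewrite -scalerAr hgen_hTperm.
  (* The part evaluated at [srefl b * p] is separated from the part evaluated at [p]; reindexing the
     former by [srefl b] gives [hgen_hTperm]. *)
  transitivity (\sum_p ((if ascent p b then q else 1) * f (srefl b * p)%g) *: Tp p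
     + \sum_p ((if ascent p b then 0 else q - 1) * f p) *: Tp p).
    rewrite -big_split /=; apply: eq_bigr => p _; rewrite -scalerDl.
    by congr (_ *: _); rewrite /regular_gen; case: ifP => _; ring.
  rewrite [X in X + _](reindex_inj (mulgI (srefl b))) -big_split /=; apply: eq_bigr => p _.
  rewrite sreflK ascent_srefl; case: (ascent p b) => /=.
    by rewrite mul1r mul0r scale0r addr0.
  by rewrite scalerDr !scalerA addrC [f p * q]mulrC [f p * (_ - _)]mulrC.
- transitivity (a *: \sum_p f p *: Tp p) => //.
  rewrite scaler_sumr; apply: eq_bigr => p _.
  by rewrite scalerA.
- under eq_bigr => p _ do rewrite scalerDl.
  rewrite big_split /= IHx IHy -mulrDl; congr (_ * _).
  by rewrite -[LHS]/(hadd _ _) hpiD.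
- by rewrite IHx IHy mulrA -[hpi q x * hpi q y]/(hmul _ _) hpiM.
Qed.

End StandardBasis.

Lemma hecke_torsion_free (R : idomainType) (n : nat) (q a : R) (x y : hecke n q) :
  a != 0 -> a *: x = a *: y -> x = y.
Proof.
move=> a0 /eqP; rewrite -subr_eq0 -scalerBr => /eqP ax.
apply/eqP; rewrite -subr_eq0; apply/eqP; move: (x - y) ax => {x y}.
elim/hpiW => t; rewrite -[_ *: _]/(hmul _ _) hpiM => /hpiP /regular_cong at0.
(* [f] is the coordinate vector of 1, so by [regularE] the values [regular t f p] are coefficients
   of the class of [t], and [a] kills each of them. *)
pose f (p : 'S_n) : R := (p == 1%g)%:R.
have e1 : \sum_p f p *: hTperm q p = 1.
  rewrite (bigD1 1%g) //= /f eqxx scale1r hTperm1 big1 ?addr0 // => p /negbTE ->.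
  by rewrite scale0r.
have := regularE q t f; rewrite e1 mulr1 => <-.
apply: big1 => p _; suff -> : regular q t f p = 0 by rewrite scale0r.
apply/eqP; have := congr1 (fun h => h f p) at0; rewrite /= mul0r => /eqP.
by rewrite mulf_eq0 (negbTE a0).
Qed.

(** * Transpositions and their lengths *)

Section Transpositions.
Variables (R : comNzRingType) (n : nat) (q : R).
Local Notation Tp := (@hTperm R n q).
Local Notation T := (hT n q).

Lemma hT_gen (b : 'I_n.-1) : T b.+1 = hgen n q b.
Proof. by rewrite /hT valK. Qed.

Lemma transpE i j (hi : (i < n)%N) (hj : (j < n)%N) :
  transp n i.+1 j.+1 = tperm (Ordinal hi) (Ordinal hj).
Proof. by rewrite /transp /= !insubT. Qed.

(** Conjugation by [srefl b] moves [lo b] to [hi b] and fixes [x]. The multiplication on the right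
    is turned into one on the left by [invnumV]. *)
Lemma invnum_tperm_hi (x : 'I_n) (b : 'I_n.-1) : (x < b)%N ->
  tperm x (hi b) = (srefl b * (tperm x (lo b) * srefl b))%g /\
  invnum (srefl b * (tperm x (lo b) * srefl b)) = (invnum (tperm x (lo b))).+2 /\
  invnum (tperm x (lo b) * srefl b) = (invnum (tperm x (lo b))).+1.
Proof.
move=> xb.
have x1 : srefl b x = x by apply: srefl_fix; lia.
have x2 : tperm x (lo b) (hi b) = hi b.
  by rewrite tpermD // -val_eqE /=; lia.
have i1 : invnum (tperm x (lo b) * srefl b) = (invnum (tperm x (lo b))).+1.
  rewrite -invnumV invMg !tpermV invnum_srefl_ascent //.
  by rewrite /ascent tpermR x2 /=; lia.
split; last split=> //.
  have -> : (srefl b * (tperm x (lo b) * srefl b) = tperm x (lo b) ^ srefl b)%g.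
    by rewrite conjgE tpermV.
  by rewrite tpermJ x1 srefl_lo.
rewrite invnum_srefl_ascent ?i1 //.
by rewrite /ascent !permM tpermR x1 x2 srefl_hi /=; lia.
Qed.

Lemma hTperm_transp_adj m : (0 < m < n)%N -> Tp (transp n m m.+1) = T m.
Proof.
case: m => // m hm; have hb : (m < n.-1)%N by lia.
rewrite -[m]/(val (Ordinal hb)) hT_gen -hTperm_srefl; congr hTperm.
exact: transp_srefl.
Qed.

Lemma hTperm_transp_step i m : (0 < i < m)%N -> (m < n)%N ->
  Tp (transp n i m.+1) = T m * Tp (transp n i m) * T m.
Proof.
case: i m => // i [//|m] im hm; have hb : (m < n.-1)%N by lia.
have hin : (i < n)%N by lia.
set b := Ordinal hb; rewrite -[m]/(val b) hT_gen.
rewrite (transpE hin (hi_subproof b)) (transpE hin (lo_subproof b)).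
have [-> [i2 i1]] := @invnum_tperm_hi (Ordinal hin) b im.
have ib : invnum (srefl b) = 1%N.
  have := @invnum_srefl_ascent n b 1; rewrite mulg1 invnum1; apply.
  by rewrite /ascent !perm1 /=.
rewrite hTpermM; last by rewrite i2 ib i1.
by rewrite hTpermM ?hTperm_srefl ?mulrA // i1 ib addn1.
Qed.

End Transpositions.

(** * The undivided identity *)

Section QIntegers.
Variables (R : comNzRingType) (q : R).

Lemma qintS k : qint q k.+1 = qint q k + q ^+ k.
Proof. exact: big_ord_recr. Qed.

Lemma qint0 : qint q 0 = 0. Proof. exact: big_ord0. Qed.

Lemma qintD k l : qint q (k + l) = qint q k + q ^+ k * qint q l.
Proof.
elim: l => [|l IH]; first by rewrite addn0 qint0 mulr0 addr0.
by rewrite addnS !qintS IH exprD mulrDr addrA.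
Qed.

Lemma expr_qint k : q ^+ k = (q - 1) * qint q k + 1.
Proof.
elim: k => [|k IH]; first by rewrite qint0 mulr0 add0r.
by rewrite qintS exprS {1}IH; ring: IH.
Qed.

Lemma qfactS k : qfact q k.+1 = qfact q k * qint q k.+1.
Proof. exact: big_nat_recr. Qed.

End QIntegers.

(** Induction step of [hB_hBB], where [b], [b'], [bs], [t], [P], [P'] stand for
    B_(m+1), B_(m+2), B*_(m+1), T_(m+1), P_(m+2), P_(m+1), while [r0], [r1], [rho]
    are the undivided R_(m,k), R_(m,k+1), R_(m+1,k+1), and [e = q^k]. *)
Lemma hBB_step (R : comNzRingType) (q : R) (A : algType R)
    (b b' bs t P P' r0 r1 rho : A) (Q M c d e : R) :
  t * (b * b') = q *: (b * b') ->
  GRing.comm t r0 -> GRing.comm t r1 -> GRing.comm P bs ->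
  P = c *: t + t * P' * t -> rho = bs * r0 * b ->
  q * e * d + Q * (q * (q * e * M) - q * c) = (Q + q * e) * (q * e * M) ->
  e *: (b * rho) = ((q * (e * e)) *: r1 + Q *: (((e * M)%:A + P') * r0)) * b ->
  (q * e) *: ((bs * t * b + d%:A + P) * rho * b') =
  ((q ^+ 3 * (e * e)) *: (bs * r1 * b) +
   (Q + q * e) *: (((q * e * M)%:A + P) * rho)) * b'.
Proof.
set z := b * b' => tz tr0 tr1 Pbs PE rhoE scalars ih.
have tr1z : t * (r1 * z) = q *: (r1 * z) by rewrite mulrA tr1 -mulrA tz -scalerAr.
have tr0z : t * (r0 * z) = q *: (r0 * z) by rewrite mulrA tr0 -mulrA tz -scalerAr.
(* [P'] is known only through [t * P' * t]; the missing right factor [t] is created by [tr0z], at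
   the cost of the scalar [q]. *)
have tPz : q *: (t * (P' * (r0 * z))) = P * (r0 * z) - (q * c) *: (r0 * z).
  rewrite scalerAr scalerAr -tr0z !mulrA.
  have -> : t * P' * t = P - c *: t by rewrite PE [c *: t + _]addrC addrK.
  by rewrite !mulrBl -!scalerAl -!mulrA tr0z scalerA [c * q]mulrC.
have ihz : e *: (b * rho * b') = (q * (e * e)) *: (r1 * z)
    + (Q * (e * M)) *: (r0 * z) + Q *: (P' * (r0 * z)).
  rewrite scalerAl ih -mulrA -/z mulrDl -!scalerAl -addrA; congr (_ + _).
  by rewrite !mulrDl scalerDr -!scalerAl mul1r scalerA -[P' * r0 * z]mulrA.
have tbz : (q * e) *: (t * (b * rho * b')) = (q ^+ 3 * (e * e)) *: (r1 * z)
    + (Q * (q * (q * e * M) - q * c)) *: (r0 * z) + Q *: (P * (r0 * z)).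
  rewrite -scalerA scalerAr ihz !mulrDr !scalerDr -!scalerAr tr1z tr0z !scalerA.
  rewrite [q * Q]mulrC -[(Q * q) *: _]scalerA tPz scalerBr !scalerA.
  rewrite addrA addrAC; congr (_ + _); rewrite -addrA -scalerBl.
  by congr (_ *: _ + _ *: _); ring.
have e0 : bs * (r0 * z) = rho * b' by rewrite rhoE !mulrA.
have e2 : bs * (P * (r0 * z)) = P * (rho * b') by rewrite mulrA -Pbs -mulrA e0.
rewrite -[_ * rho * b']mulrA !mulrDl !scalerDr.
have -> : bs * t * b * (rho * b') = bs * (t * (b * rho * b')) by rewrite !mulrA.
rewrite scalerAr tbz; set f := Q * (_ - _); rewrite !mulrDr -!scalerAr e0 e2 -!scalerAl !mul1r.
have -> : bs * (r1 * z) = bs * r1 * b * b' by rewrite !mulrA.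
rewrite mulrDl -!scalerAl -[P * rho * _]mulrA !scalerA -scalars -/f !scalerDl.
by rewrite !addrA [LHS](ACl (1*4*2*3*5)).
Qed.

(** * Commutation and recursions for T, B, B* and P *)

Section RandomToBelow.
Variables (R : comNzRingType) (n : nat) (q : R).
Local Notation T := (hT n q).
Local Notation B := (hB n q).
Local Notation Bs := (hBs n q).
Local Notation comm := GRing.comm.
Implicit Types (i j m k : nat) (x y : hecke n q).

(** As [hT n q 0 = 0], the commutation and braid relations below and the
    recursions for [hB] and [hBs] also hold at index 0. *)
Lemma hTP i : (i < n)%N -> T i = 0 /\ i = 0%N \/ exists b : 'I_n.-1, i = b.+1.
Proof.
case: i => [|i] hi; first by left.
have hb : (i < n.-1)%N by lia.
by right; exists (Ordinal hb).
Qed.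

Lemma hT_quad i : (0 < i < n)%N -> T i * T i = (q - 1) *: T i + q%:A.
Proof.
move=> /andP[i0 /hTP[[_ e]|[b ->]]]; first by rewrite e in i0.
by rewrite hT_gen; case: (hgen_relations n q).
Qed.

Lemma hT_comm i j : (i.+1 < j < n)%N -> comm (T i) (T j).
Proof.
move=> /andP[ij jn]; have [c jc] : exists c : 'I_n.-1, j = c.+1.
  by case: (hTP jn) => // -[_ e]; rewrite e in ij.
have [[-> _]|[b ib]] : T i = 0 /\ i = 0%N \/ exists b : 'I_n.-1, i = b.+1.
- by apply: hTP; lia.
- exact/commr_sym/commr0.
- rewrite ib jc /comm !hT_gen; case: (hgen_relations n q) => _ h _.
  by apply: h; lia.
Qed.

Lemma hT_braid m : (m.+1 < n)%N -> T m * T m.+1 * T m = T m.+1 * T m * T m.+1.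
Proof.
move=> mn; have [c mc] : exists c : 'I_n.-1, m.+1 = c.+1.
  by case: (hTP mn) => // -[].
have [[-> _]|[b mb]] : T m = 0 /\ m = 0%N \/ exists b : 'I_n.-1, m = b.+1.
- by apply: hTP; lia.
- by rewrite !mul0r mulr0 mul0r.
- rewrite mc mb !hT_gen; case: (hgen_relations n q) => _ _; apply.
  by case: mc; rewrite mb.
Qed.

Lemma hB0 : B 0 = 0. Proof. exact: big_geq. Qed.
Lemma hBs0 : Bs 0 = 0. Proof. exact: big_geq. Qed.

Lemma rev_index_iota i m : (i <= m)%N ->
  rev (index_iota i m.+1) = m :: rev (index_iota i m).
Proof.
move=> im; rewrite /index_iota subSn // -[(m - i).+1]addn1 iotaD rev_cat /=.
by rewrite subnKC.
Qed.

Lemma hBS m : B m.+1 = 1 + T m * B m.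
Proof.
rewrite /hB big_nat_recr //= [X in _ + X]big1_seq; last first.
  by move=> j; rewrite /index_iota subnn.
rewrite addrC mulr_sumr; congr (_ + _); apply: eq_big_nat => i /andP[_ im].
by rewrite rev_index_iota // big_cons.
Qed.

Lemma hBsS m : Bs m.+1 = 1 + Bs m * T m.
Proof.
rewrite /hBs big_nat_recr //= [X in _ + X]big_geq // addrC mulr_suml.
by congr (_ + _); apply: eq_big_nat => i /andP[_ im]; rewrite big_nat_recr.
Qed.

Lemma comm_hB x m : (forall j, (j < m)%N -> comm x (T j)) -> comm x (B m).
Proof.
elim: m => [|m IH] h; first by rewrite hB0; exact: commr0.
rewrite hBS; apply: commrD; first exact: commr1.
by apply: commrM; [exact: h|apply: IH => j jm; apply: h; lia].
Qed.

Lemma comm_hBs x m : (forall j, (j < m)%N -> comm x (T j)) -> comm x (Bs m).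
Proof.
elim: m => [|m IH] h; first by rewrite hBs0; exact: commr0.
rewrite hBsS; apply: commrD; first exact: commr1.
by apply: commrM; [apply: IH => j jm; apply: h; lia|exact: h].
Qed.

(** [q^m J_m], with the division in the definition of [J_m] cleared. *)
Fixpoint qJ m : hecke n q :=
  if m is j.+1 then q ^+ j *: T j + T j * qJ j * T j else 0.

Lemma qJS m : qJ m.+1 = q ^+ m *: T m + T m * qJ m * T m.
Proof. by []. Qed.

(** The recursion for [qJ] splits off the adjacent transposition; [hTperm_transp_step] obtains the
    others from those on one strand fewer. *)
Lemma qJE m : (m <= n)%N ->
  qJ m = \sum_(1 <= i < m) q ^+ i *: hTperm q (transp n i m).
Proof.
elim: m => [|m IH] mn; first by rewrite big_geq.
case: m IH mn => [|m] IH mn.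
  by rewrite /= mulr0 scaler0 addr0 big_geq.
rewrite qJS IH; last by lia.
rewrite [RHS]big_nat_recr // hTperm_transp_adj ?mn // [LHS]addrC.
congr (_ + _); rewrite mulr_sumr mulr_suml; apply: eq_big_nat => i im.
by rewrite [in RHS]hTperm_transp_step // -scalerAr -scalerAl.
Qed.

Lemma comm_qJ x m : (forall j, (j < m)%N -> comm x (T j)) -> comm x (qJ m).
Proof.
elim: m => [|m IH] h; first exact: commr0.
have xT : comm x (T m) by exact: h.
have xJ : comm x (qJ m) by apply: IH => j jm; apply: h; lia.
rewrite qJS; apply: commrD; first by rewrite /comm -scalerAr -scalerAl xT.
by apply: commrM => //; exact: commrM.
Qed.

(** Below the largest [j], [T j] commutes with the outer factor and induction applies. For the
    largest [j] the recursion is unrolled twice: braid relations carry [S] through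
    [t * S * P * S * t], and [q t + t S t] commutes with [S] by the quadratic relation. *)
Lemma qJ_comm m j : (m < n)%N -> (j < m)%N -> comm (T j) (qJ m.+1).
Proof.
elim: m j => // m IH j mn; rewrite ltnS leq_eqVlt => /orP[/eqP ->|jm]; last first.
  have jT : comm (T j) (T m.+1) by apply: hT_comm; lia.
  rewrite qJS; apply: commrD; first by rewrite /comm -scalerAr -scalerAl jT.
  by apply: commrM => //; apply: commrM => //; apply: IH => //; lia.
case: m IH mn => [|m] IH mn.
  by apply/commr_sym; exact: commr0.
set S := T m.+1; set t := T m.+2.
have tST : S * t * S = t * S * t by exact: hT_braid.
have St : S * S = (q - 1) *: S + q%:A by apply: hT_quad; lia.
have tP : comm t (qJ m.+1) by apply: comm_qJ => i im; apply/commr_sym/hT_comm; lia.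
rewrite qJS -/t qJS -/S mulrDr mulrDl addrA; apply: commrD; last first.
  rewrite /comm !mulrA tST -[t * S * t * _]mulrA tP -[RHS]mulrA -[RHS]mulrA.
  by rewrite [S * (t * S)]mulrA tST !mulrA.
rewrite -scalerAr -scalerAl exprSr -scalerA -scalerDr /comm -scalerAl -scalerAr.
congr (_ *: _); rewrite -tST mulrDr mulrDl -scalerAl -scalerAr.
rewrite !mulrA St -[S * t * S * S]mulrA St mulrDl !mulrDr mulrDl.
rewrite -?scalerAl -?scalerAr ?mulr1 ?mul1r -?scalerAl scale1r.
by rewrite addrC addrAC addrC.
Qed.


Lemma mul_hB_hBs m : (m < n)%N ->
  B m.+1 * Bs m.+1 = Bs m * T m * B m + (qint q m.+1)%:A + qJ m.+1.
Proof.
elim: m => [|m IH] mn.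
  rewrite hBS hBsS hB0 hBs0 mulr0 !mul0r addr0 mulr1 qintS qint0 expr0 !add0r.
  by rewrite scale1r qJS /= scaler0 mulr0 !addr0.
set t := T m.+1; set b := B m.+1; set bs := Bs m.+1.
have b1 : b = 1 + T m * B m by exact: hBS.
have bs1 : bs = 1 + Bs m * T m by exact: hBsS.
have tt : t * t = (q - 1) *: t + q%:A by apply: hT_quad.
have tB : comm t (B m) by apply: comm_hB => j jm; apply/commr_sym/hT_comm; lia.
have tBs : comm t (Bs m) by apply: comm_hBs => j jm; apply/commr_sym/hT_comm; lia.
(* This braid move brings the inductive term into the shape of the last summand of [bs * t * b],
   expanded in [expand]. *)
have sandwich : t * (Bs m * T m * B m) * t = (Bs m * T m) * t * (T m * B m).
  rewrite !mulrA tBs -[_ * B m * t]mulrA -tB !mulrA -[Bs m * t * T m]mulrA.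
  by rewrite -[Bs m * (t * T m) * t]mulrA -(hT_braid mn) !mulrA.
have expand : t * b + bs * t + (Bs m * T m) * t * (T m * B m) = bs * t * b + t.
  rewrite b1 bs1; set u := Bs m * T m; set v := T m * B m.
  rewrite !mulrDl !mulrDr !mul1r !mulr1 !addrA.
  by rewrite [LHS](ACl (1*2*4*5*3)) /=.
rewrite hBS hBsS -/t -/b -/bs mulrDl !mulrDr mul1r !mulr1.
have -> : t * b * (bs * t) = t * (b * bs) * t by rewrite !mulrA.
rewrite IH ?[qJ m.+2]qJS -/t; last by lia.
move: (qJ m.+1) => P.
rewrite !mulrDr !mulrDl sandwich -scalerAr mulr1 -scalerAl tt.
(* The term [[m+1]_q t^2] contributes [q [m+1]_q], which 1 completes to [[m+2]_q], and
   [(q^(m+1) - 1) t], whose deficit of one [t] against P_(m+2) is the [t] in [expand]. *)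
have e : q ^+ m.+1 = qint q m.+1 * (q - 1) + 1 by rewrite expr_qint mulrC.
have e' : qint q m.+2 = qint q m.+1 * q + 1 by rewrite qintS e; ring.
rewrite e e' mul1r [_ *: (_ + _)]scalerDr !scalerA.
rewrite [(_ + 1)%:A]scalerDl [(_ + 1) *: t]scalerDl !scale1r.
move: expand; set X := t * b; set Y := bs * t; set Z := _ * t * _; set W := bs * t * b.
set U := t * P * t; set c1 := _ *: t; set c2 := _%:A => expand.
rewrite !addrA [RHS](ACl (1*5*3*4*2*6)) /= -expand.
by rewrite [LHS](ACl (3*2*4*1*5*6*7)).
Qed.

(** In the induction [b * B k.+2] splits as [(b + t b) + s t a b]: the quadratic relation handles
    the first part, and the braid relation reduces the second to the eigenvector [a b] of [s]. *)
Lemma hT_hB_hB m : (m.+1 < n)%N ->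
  T m.+1 * (B m.+1 * B m.+2) = q *: (B m.+1 * B m.+2).
Proof.
suff H k : (k < n)%N -> T k * (B k * B k.+1) = q *: (B k * B k.+1) by exact: H.
elim: k => [|k IH] kn; first by rewrite hB0 !mul0r scaler0.
set t := T k.+1; set b := B k.+1; set s := T k; set a := B k.
have b1 : b = 1 + s * a by exact: hBS.
have ta : comm t a by apply: comm_hB => j jm; apply/commr_sym/hT_comm; lia.
have tt : t * t = (q - 1) *: t + q%:A by apply: hT_quad.
have sab : s * a * b = q *: (a * b) by rewrite -mulrA; apply: IH; lia.
have X : b * B k.+2 = b + t * b + s * t * a * b.
  rewrite hBS -/t -/b mulrDr mulr1 -addrA; congr (_ + _).
  rewrite {1}b1 mulrDl mul1r; congr (_ + _).
  by rewrite !mulrA -[s * a * t]mulrA -ta !mulrA.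
have tb : t * b + t * t * b = q *: b + q *: (t * b).
  rewrite tt mulrDl -!scalerAl mul1r scalerBl scale1r.
  by rewrite addrA [t * b + _]addrC subrK addrC.
have tst : t * (s * t * a * b) = q *: (s * t * a * b).
  rewrite !mulrA -(hT_braid kn) -/s -/t -[s * t * s * a]mulrA -mulrA.
  by rewrite sab -scalerAr !mulrA.
by rewrite X !mulrDr tst [t * (t * b)]mulrA tb !scalerDr.
Qed.


(** * The products B_(m,k) and B*_(m,k) *)

Local Notation Bp := (hBprod n q).
Local Notation Bsp := (hBsprod n q).

Lemma hBprod0 m : Bp m 0 = 1. Proof. by rewrite /hBprod subn0 big_geq. Qed.

Lemma hBsprod0 m : Bsp m 0 = 1.
Proof. by rewrite /hBsprod subn0 /index_iota subnn big_nil. Qed.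

Lemma hBprodS m k : Bp m.+1 k.+1 = Bp m k * B m.+1.
Proof. by rewrite /hBprod subSS big_nat_recr //; lia. Qed.

Lemma hBsprodS m k : Bsp m.+1 k.+1 = Bs m.+1 * Bsp m k.
Proof. by rewrite /hBsprod subSS rev_index_iota ?big_cons //; lia. Qed.

(** For [k = m] the factor split off is [Bs 0 = 0]. *)
Lemma hBsprodSr m k : (k <= m)%N -> Bsp m k.+1 = Bsp m k * Bs (m - k).
Proof.
elim: m k => [|m IH] [|k] km //.
- by rewrite hBsprod0 /hBsprod mul1r /index_iota /= big_seq1.
- by rewrite hBsprod0 mul1r hBsprodS hBsprod0 mulr1.
- by rewrite hBsprodS IH // subSS [Bsp m.+1 _]hBsprodS mulrA.
Qed.

Lemma hBprod_gt m k : (m < k)%N -> Bp m k = 0.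
Proof.
elim: m k => [|m IH] [|k] // mk; last by rewrite hBprodS IH // mul0r.
by rewrite /hBprod big_ltn // hB0 mul0r.
Qed.

(** [\mathcal{R}_{m,k}] before the division by [[k]!_q]. *)
Definition hBB m k := Bsp m k * Bp m k.

Lemma hBB0 m : hBB m 0 = 1. Proof. by rewrite /hBB hBprod0 hBsprod0 mulr1. Qed.

Lemma hBB1 m : hBB m 1 = Bs m * B m.
Proof.
case: m => [|m]; first by rewrite /hBB hBprod_gt // hB0 !mulr0.
by rewrite /hBB hBprodS hBsprodS hBprod0 hBsprod0 mul1r mulr1.
Qed.

Lemma hBBS m k : hBB m.+1 k.+1 = Bs m.+1 * hBB m k * B m.+1.
Proof. by rewrite /hBB hBsprodS hBprodS !mulrA. Qed.

Lemma comm_hBprod x m k : (forall j, (j < m)%N -> comm x (T j)) -> comm x (Bp m k).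
Proof.
elim: m k => [|m IH] [|k] h; rewrite ?hBprod0; try exact: commr1.
  by rewrite hBprod_gt //; exact: commr0.
rewrite hBprodS; apply: commrM; last exact: comm_hB.
by apply: IH => j jm; apply: h; lia.
Qed.

Lemma comm_hBB x m k : (forall j, (j < m)%N -> comm x (T j)) -> comm x (hBB m k).
Proof.
elim: m k => [|m IH] [|k] h; rewrite ?hBB0; try exact: commr1.
  by rewrite /hBB hBprod_gt // mulr0; exact: commr0.
rewrite hBBS; apply: commrM; last exact: comm_hB.
apply: commrM; first exact: comm_hBs.
by apply: IH => j jm; apply: h; lia.
Qed.

(** For the largest [i], [hT_hB_hB] applies to the last two factors and [T i] commutes with the
    earlier ones; a smaller [i] is handled in a shorter product. *)
Lemma hT_hBprod i m k : (m <= n)%N -> (m - k < i < m)%N -> T i * Bp m k = q *: Bp m k.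
Proof.
elim: m k => [|m IH] [|k] mn; [lia|lia|lia|].
rewrite subSS ltnS => /andP[ki]; rewrite leq_eqVlt => /orP[/eqP e|im]; last first.
  by rewrite hBprodS mulrA IH ?scalerAl //; lia.
rewrite e in ki *.
case: m k {IH e} mn ki => [|m] [|k] mn ki; [lia|lia|lia|].
have tB : comm (T m.+1) (Bp m k).
  by apply: comm_hBprod => j jm; apply/commr_sym/hT_comm; lia.
rewrite hBprodS hBprodS -[Bp m k * _ * _]mulrA mulrA tB -mulrA hT_hB_hB //.
by rewrite -scalerAr.
Qed.

(** The factor [q ^+ k] avoids negative powers: it turns [q^(m+1-k) J_(m+1)] into [qJ m.+1]. *)
Lemma hB_hBB m k : (m < n)%N -> (k <= m)%N ->
  q ^+ k *: (B m.+1 * hBB m.+1 k.+1) =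
  (q ^+ (2 * k).+1 *: hBB m k.+1
   + qint q k.+1 *: (((q ^+ k * qint q (m.+1 - k))%:A + qJ m.+1) * hBB m k))
  * B m.+1.
Proof.
elim: k m => [|k IH] m mn km.
  rewrite muln0 expr0 expr1 !scale1r mul1r subn0 hBBS hBB0 hBB1 !mulr1.
  rewrite qintS qint0 add0r expr0 scale1r mulrA mul_hB_hBs // -addrA !mulrDl.
  congr (_ + _); case: m mn km => [|m] mn _; first by rewrite hB0 !mulr0 !mul0r scaler0 mul0r.
  rewrite -[Bs _ * _ * _ * _]mulrA -[Bs _ * _ * _]mulrA hT_hB_hB //.
  by rewrite -scalerAl -scalerAr mulrA.
case: m mn km => // m mn km.
have tT j : (j < m)%N -> comm (T m.+1) (T j).
  by move=> jm; apply/commr_sym/hT_comm; lia.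
have mk : (m.+1 = k + (m.+1 - k))%N by rewrite subnKC // ltnW.
have eqk : q ^+ m.+1 = q ^+ k * ((q - 1) * qint q (m.+1 - k) + 1).
  by rewrite {1}mk exprD -expr_qint.
have qintm : qint q m.+2 = qint q k.+1 + q ^+ k.+1 * qint q (m.+1 - k).
  by rewrite -qintD; congr qint; lia.
have e3 : q ^+ (2 * k.+1).+1 = q ^+ 3 * (q ^+ k * q ^+ k).
  by rewrite -!exprD; congr (_ ^+ _); lia.
rewrite subSS [qint q k.+2]qintS e3 [q ^+ k.+1]exprS.
rewrite [hBB m.+2 k.+2]hBBS [hBB m.+1 k.+2]hBBS.
rewrite [B m.+2 * _]mulrA [B m.+2 * (_ * _)]mulrA mul_hB_hBs //.
(* The scalars [Q], [M], [c], [d] are here [[k+1]_q], [[m+1-k]_q], [q^(m+1)], [[m+2]_q]. *)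
apply: (@hBB_step _ q _ _ _ _ _ _ (qJ m.+1) (hBB m k) _ _ _ _ (q ^+ m.+1)).
- exact: hT_hB_hB.
- exact: comm_hBB.
- exact: comm_hBB.
- by apply: comm_hBs => j jm; apply/commr_sym/qJ_comm; lia.
- exact: qJS.
- exact: hBBS.
- by rewrite qintm eqk exprS; ring.
- rewrite IH //; last by lia.
  by congr ((_ *: _ + _) * _); rewrite -exprD -exprS; congr (_ ^+ _); lia.
Qed.

(** * Divisibility by the q-factorial *)

Definition desc m k : hecke n q := \prod_(i < k) T (m - i).

Lemma descSr m k : desc m k.+1 = desc m k * T (m - k).
Proof. exact: big_ord_recr. Qed.

Lemma comm_desc x m k :
  (forall j, (m - k < j <= m)%N -> comm x (T j)) -> (k <= m)%N -> comm x (desc m k).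
Proof.
move=> h km; elim: k km h => [|k IH] km h; first by rewrite /desc big_ord0; exact: commr1.
rewrite descSr; apply: commrM; last by apply: h; lia.
by apply: IH => [|j jm]; [|apply: h]; lia.
Qed.

(** [T i] commutes with the factors before [T i.+1 * T i], becomes [T i.+1] there by the braid
    relation, and commutes with the rest. *)
Lemma hT_desc i m k : (m < n)%N -> (k <= m)%N -> (m.+1 - k <= i < m)%N ->
  T i * desc m k = desc m k * T i.+1.
Proof.
move=> mn; elim: k => [|k IH] km ik; first by lia.
have [e|ne] := eqVneq i (m - k)%N.
  case: k IH km ik e => [|k] _ km ik e; first by lia.
  have ci : comm (T i) (desc m k).
    by apply: comm_desc; last lia; move=> j jm; apply: hT_comm; lia.
  rewrite !descSr.
  have -> : (m - k = i.+1)%N by lia.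
  have -> : (m - k.+1 = i)%N by lia.
  rewrite !mulrA ci -!mulrA; congr (_ * _); rewrite !mulrA.
  by apply: hT_braid; lia.
rewrite descSr mulrA IH; [|lia|lia].
by rewrite -!mulrA; congr (_ * _); apply/commr_sym/hT_comm; lia.
Qed.

Lemma desc_eigen m k x : (k <= m)%N ->
  (forall i, (m - k < i <= m)%N -> T i * x = q *: x) -> desc m k * x = q ^+ k *: x.
Proof.
elim: k => [|k IH] km h; first by rewrite /desc big_ord0 mul1r expr0 scale1r.
rewrite descSr -mulrA h; last by lia.
rewrite -scalerAr IH ?scalerA -?exprS //; first by lia.
by move=> i im; apply: h; lia.
Qed.

(** The sum of [T_w] over the minimal length representatives of the cosets of
    S_(m-k) x S_k in S_m; the two summands of the recursion correspond to the
    image of [m] being moved into the last [k] strands or out of them. *)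
Fixpoint shuffle m k : hecke n q :=
  match m, k with
  | _, 0 => 1
  | 0, _.+1 => 0
  | m'.+1, k'.+1 => shuffle m' k' + shuffle m' k'.+1 * desc m' k'.+1
  end.

Lemma shuffle0 m : shuffle m 0 = 1. Proof. by case: m. Qed.

Lemma shuffleS m k :
  shuffle m.+1 k.+1 = shuffle m k + shuffle m k.+1 * desc m k.+1.
Proof. by []. Qed.

Lemma shuffle_gt m k : (m < k)%N -> shuffle m k = 0.
Proof.
elim: m k => [|m IH] [|k] // mk; rewrite shuffleS !IH; [|lia|lia].
by rewrite mul0r addr0.
Qed.

(** At q = 1 this reflects that a set of k+1 elements arises in k+1 ways by adding an element to a
    set of k. The condition [0 < i] excludes [T 0 = 0], which falls in the range when
    [m - k = 0]. *)
Lemma shuffle_hBs m k x : (m <= n)%N ->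
  (forall i, (0 < i)%N -> (m - k <= i < m)%N -> T i * x = q *: x) ->
  shuffle m k * Bs (m - k) * x = qint q k.+1 *: (shuffle m k.+1 * x).
Proof.
elim: m k x => [|m IH] k x mn h; first by rewrite hBs0 mulr0 !mul0r scaler0.
(* By [hT_desc], [desc m j.+1 * x] is an eigenvector for the indices lowered by one, so induction
   applies to it. For [j >= m] both sides vanish. *)
have step j : (forall i, (0 < i)%N -> (m.+1 - j <= i < m.+1)%N -> T i * x = q *: x) ->
    shuffle m j * (Bs (m - j) * (desc m j.+1 * x)) =
    qint q j.+1 *: (shuffle m j.+1 * (desc m j.+1 * x)).
  move=> hx; have [jm|mj] := ltnP j m; last first.
    by rewrite (_ : (m - j = 0)%N) ?hBs0 ?(@shuffle_gt m j.+1) ?mul0r ?mulr0 ?scaler0 //; lia.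
  rewrite mulrA IH //; first by lia.
  move=> i i0 im; rewrite mulrA hT_desc; [|lia|lia|lia].
  by rewrite -mulrA hx ?scalerAr //; lia.
case: k h => [|k] h.
  rewrite subn0 hBsS shuffle0 mul1r shuffleS shuffle0 qintS qint0 expr0 add0r scale1r.
  have := step 0%N; rewrite shuffle0 mul1r subn0 qintS qint0 expr0 add0r scale1r.
  rewrite descSr /desc big_ord0 mul1r subn0 => st.
  by rewrite !mulrDl -[Bs m * _ * x]mulrA -[shuffle m 1 * _ * x]mulrA st.
have [km|mk] := ltnP k m; last first.
  rewrite (_ : (m.+1 - k.+1 = 0)%N) ?hBs0 ?mulr0 ?mul0r; last by lia.
  by rewrite shuffle_gt ?mul0r ?scaler0 //; lia.
have hx i : (0 < i)%N -> (m - k <= i < m.+1)%N -> T i * x = q *: x.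
  by move=> i0 im; apply: h.
rewrite subSS !shuffleS !mulrDl IH; [|lia|by move=> i i0 im; apply: hx; lia].
(* In [Bs (m - k) = 1 + Bs (m - k.+1) * T (m - k.+1)] the summand 1 yields [q ^+ k.+1], and the
   other lengthens [desc] by one factor, as [step] requires. *)
have -> : shuffle m k.+1 * desc m k.+1 * Bs (m - k) * x =
    q ^+ k.+1 *: (shuffle m k.+1 * x)
    + qint q k.+2 *: (shuffle m k.+2 * (desc m k.+2 * x)).
  rewrite -step; last by move=> i i0 im; apply: hx; lia.
  have -> : (m - k = (m - k.+1).+1)%N by lia.
  have cB : GRing.comm (Bs (m - k.+1)) (desc m k.+1).
    apply: comm_desc => // j jm; apply/commr_sym/comm_hBs => i im.
    by apply/commr_sym/hT_comm; lia.
  have dx : desc m k.+1 * x = q ^+ k.+1 *: x.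
    by apply: desc_eigen => // i im; apply: hx; lia.
  rewrite hBsS mulrDr mulr1 mulrDl -[_ * desc _ _ * x]mulrA dx -scalerAr; congr (_ + _).
  by rewrite [desc m k.+2]descSr -!mulrA; congr (_ * _); rewrite !mulrA cB.
by rewrite addrA -scalerDl -qintS -[shuffle m k.+2 * _ * x]mulrA -scalerDr.
Qed.

(** [Bs (m - k)] commutes with [T i] for [i > m - k], so [Bs (m - k) * x] remains an eigenvector on
    the range needed for [k]. *)
Lemma hBsprod_factor m k x : (m <= n)%N -> (k <= m)%N ->
  (forall i, (m - k < i < m)%N -> T i * x = q *: x) ->
  Bsp m k * x = qfact q k *: (shuffle m k * x).
Proof.
move=> mn; elim: k x => [|k IH] x km hx.
  by rewrite hBsprod0 shuffle0 /qfact big_geq // scale1r.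
rewrite hBsprodSr; last by lia.
rewrite -mulrA IH; last 2 first.
- by lia.
- move=> i im; have cB : comm (T i) (Bs (m - k)).
    by apply: comm_hBs => j jm; apply/commr_sym/hT_comm; lia.
  by rewrite mulrA cB -mulrA hx ?scalerAr //; lia.
rewrite mulrA shuffle_hBs //; last by move=> i i0 im; apply: hx; lia.
by rewrite scalerA qfactS.
Qed.

Lemma qfact_dvd_hBB m k : (m <= n)%N -> exists r, qfact q k *: r = hBB m k.
Proof.
move=> mn; have [km|mk] := leqP k m; last first.
  by exists 0; rewrite scaler0 /hBB hBprod_gt ?mulr0.
exists (shuffle m k * Bp m k); rewrite -hBsprod_factor // => i im.
exact: hT_hBprod.
Qed.

End RandomToBelow.

(** * Specialization *)

(** Every [[j]_q] with j > 0 takes the value 1 at q = 0. *)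
Lemma qfactX_neq0 k : qfact ('X : {poly int}) k != 0.
Proof.
elim: k => [|k IH]; first by rewrite /qfact big_geq // oner_eq0.
rewrite qfactS mulf_neq0 //; apply/eqP => /(congr1 (horner_eval 0)).
rewrite /qint big_ord_recl rmorphD rmorph_sum rmorph1 rmorph0 /=.
rewrite big1 ?addr0 => [/eqP|i _]; first by rewrite oner_eq0.
by rewrite exprS rmorphM /= /horner_eval hornerX mul0r.
Qed.

Lemma hR_genericP n m k : (m <= n)%N ->
  qfact 'X k *: hR_generic n m k = hBB n 'X m k.
Proof. by move=> mn; exact: (xgetPex 0 (qfact_dvd_hBB _ k mn)). Qed.

Lemma hB_hR_generic n m k : (m < n)%N -> (k <= m)%N ->
  'X ^+ k *: (hB n 'X m.+1 * hR_generic n m.+1 k.+1) =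
  ('X ^+ (2 * k).+1 *: hR_generic n m k.+1
   + (('X ^+ k * qint 'X (m.+1 - k))%:A + qJ n 'X m.+1) * hR_generic n m k)
  * hB n 'X m.+1.
Proof.
move=> mn km; apply: (hecke_torsion_free (qfactX_neq0 k.+1)).
have swap (a b : {poly int}) (x : hecke n 'X) : a *: (b *: x) = b *: (a *: x).
  by rewrite !scalerA mulrC.
rewrite swap [qfact _ _ *: (_ * _)]scalerAr hR_genericP //.
rewrite hB_hBB // [RHS]scalerAl; congr (_ * _); rewrite scalerDr; congr (_ + _).
  by rewrite swap hR_genericP // ltnW.
(* Of [[k+1]!_q], the factor [[k+1]_q] matches the coefficient in [hB_hBB], and [[k]!_q] is absorbed
   by [hR_generic n m k]. *)
rewrite qfactS [qfact _ _ * _]mulrC -[(_ * qfact _ _) *: _]scalerA; congr (_ *: _).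
by rewrite scalerAr hR_genericP // ltnW.
Qed.

Section Specialization.
Variables (F : fieldType) (n : nat) (q : F).
Local Notation sp := (@hecke_spec F n q).

Lemma hecke_spec0 : sp 0 = 0.
Proof. by rewrite -(scale0r 0) hecke_specZ rmorph0 scale0r. Qed.

Lemma hecke_spec_hT i : sp (hT n 'X i) = hT n q i.
Proof.
case: i => [|i]; first exact: hecke_spec0.
by rewrite /hT; case: (insub i) => [b|]; [exact: hecke_spec_gen|exact: hecke_spec0].
Qed.

Lemma hecke_spec_hB m : sp (hB n 'X m) = hB n q m.
Proof.
elim: m => [|m IH]; first by rewrite !hB0 hecke_spec0.
by rewrite !hBS hecke_specD hecke_specM hecke_spec1 hecke_spec_hT IH.
Qed.

Lemma spec_expX i : spec q ('X ^+ i) = q ^+ i.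
Proof. by rewrite rmorphXn /= specX. Qed.

(** [hJ] has negative powers of q and is defined over fields only; [qJ] also makes sense over Z[q]
    and therefore carries the specialization. *)
Lemma hecke_spec_qJ m : sp (qJ n 'X m) = qJ n q m.
Proof.
elim: m => [|m IH]; first exact: hecke_spec0.
by rewrite !qJS hecke_specD hecke_specZ !hecke_specM spec_expX hecke_spec_hT IH.
Qed.

Lemma spec_qint k : spec q (qint 'X k) = qint q k.
Proof. by rewrite /qint rmorph_sum; apply: eq_bigr => i _; exact: spec_expX. Qed.

Lemma qJ_hJ : q != 0 -> qJ n q n = q ^+ n *: hJ n q.
Proof.
move=> q0; rewrite qJE // scaler_sumr; apply: eq_big_nat => i /andP[_ /ltnW im].
by rewrite scalerA -expfB_cond ?(negbTE q0) ?leq_subr // subKn.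
Qed.

End Specialization.

Theorem theorem3p6 (F : fieldType) (q : F) (n k : nat)
    (hq : q != 0) (hk1 : (1 <= k)%N) (hkn : (k <= n)%N) :
  hB n q n * hR n q n k =
  (q ^+ k *: hR n q n.-1 k
   + ((qint q (n.+1 - k))%:A + q ^+ (n.+1 - k) *: hJ n q) * hR n q n.-1 k.-1)
  * hB n q n.
Proof.
case: k hk1 hkn => // k _; case: n => // m km.
have := hB_hR_generic (ltnSn m) km.
move: (qJ _ _ _) (hecke_spec_qJ m.+1 q m.+1) => J specJ /(congr1 (@hecke_spec F m.+1 q)).
rewrite !(hecke_specZ, hecke_specM, hecke_specD) hecke_spec_hB specJ qJ_hJ //.
rewrite hecke_spec1 rmorphM /= !spec_expX spec_qint subSS.
rewrite -!/(hR _ _ _ _) => e.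
(* The extra factor [q ^+ k] of the generic identity is cancelled, as [q] is nonzero; the exponents
   agree by k + (k+1) = 2k+1 and k + (m+1-k) = m+1. *)
apply: (hecke_torsion_free (expf_neq0 k hq)); rewrite e scalerAl; congr (_ * _).
rewrite scalerDr [q ^+ k *: (_ * hR _ _ _ k)]scalerAl scalerDr !scalerA -!exprD.
by rewrite subnKC 1?ltnW // mul2n -addnn addnS.
Qed.
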